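(* Let $G$ be a countable directed graph with graph groupoid $\mathbb{G}$ and graph von Neumann algebra $M_G$, and let $T=\sum_{w\in \mathrm{Supp}(T)} t_w L_w\in M_G$ be a graph operator. Then $T$ is self-adjoint if and only if both of the following hold: (a) there exists a subset $X$ of $\mathrm{Supp}(T)$ such that $\mathrm{Supp}(T)\cap FP_r(\widehat{G}) = X\sqcup X^{-1}$ (disjoint union), where $X^{-1}=\{x^{-1}: x\in X\}$, and $t_x=\overline{t_{x^{-1}}}$ for all $x\in X$; (b) $t_v\in\mathbb{R}$ for all $v\in \mathrm{Supp}(T)\cap V(\widehat{G})$.
   Context: Graph groupoid. Let $G$ be a countable directed graph with vertex set $V(G)$ and edge set $E(G)$; an edge $e$ from $v_1$ to $v_2$ is written $e=v_1ev_2$. Its shadow is a formal oppositely directed edge $e^{-1}$ from $v_2$ to $v_1$. The shadowed graph $\widehat{G}$ has $V(\widehat{G})=V(G)$ and $E(\widehat{G})=E(G)\sqcup\{e^{-1}:e\in E(G)\}$. Two finite paths (or vertices) $w_1,w_2$ are admissible if the terminal vertex of $w_1$ is the initial vertex of $w_2$, so that the concatenation $w_1w_2$ is defined; otherwise $w_1w_2=\emptyset$ (the empty word). The graph groupoid $\mathbb{G}$ consists of all vertices and all reduced finite paths on $\widehat{G}$ (together with $\emptyset$, representing undefined products), with the product given by concatenation followed by the reduction $ww^{-1}=v$, $w^{-1}w=v'$ for $w$ with initial vertex $v$ and terminal vertex $v'$. Here $w^{-1}$ is the reversed path of shadows, and $v^{-1}=v$ for vertices. $FP_r(\widehat{G})$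 denotes the set of nonempty reduced finite paths (of length at least 1) in $\mathbb{G}$; thus $\mathbb{G}\setminus\{\emptyset\}=V(\widehat{G})\sqcup FP_r(\widehat{G})$. Operators. $H_G=l^2(\mathbb{G})$ is the graph Hilbert space with orthonormal basis $\{\xi_w: w\in\mathbb{G}\setminus\{\emptyset\}\}$, and $\xi_\emptyset=0$. For $w\in\mathbb{G}$, $L_w\in B(H_G)$ is given by $L_w\xi_{w'}=\xi_{ww'}$; then $L_w^*=L_{w^{-1}}$ and $L_{w_1}L_{w_2}=L_{w_1w_2}$. The graph von Neumann algebra $M_G$ is the weak-operator closure in $B(H_G)$ of the linear span of $\{L_w:w\in\mathbb{G}\}$. Each $T\in M_G$ has an expansion $T=\sum_{w\in\mathbb{G}}t_wL_w$ with $t_w\in\mathbb{C}$; its support is $\mathrm{Supp}(T)=\{w\in\mathbb{G}\setminus\{\emptyset\}: t_w\neq 0\}$. $T$ is a graph operator if $\mathrm{Supp}(T)$ is finite. *)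

(* Defs.v *)
From HB Require Import structures.
From mathcomp Require Import all_boot all_order all_algebra finmap.
From mathcomp Require Import complex.
From mathcomp Require Import mathcomp_extra boolp classical_sets functions.
From mathcomp Require Import cardinality fsbigop reals ereal esum numfun.
From mathcomp Require Import ring lra.

Set Implicit Arguments.
Unset Strict Implicit.
Unset Printing Implicit Defensive.
Import Order.TTheory GRing.Theory Num.Theory.

Local Open Scope classical_set_scope.
Local Open Scope ring_scope.

Record digraph := Digraph {
  vertex : countType;
  edge : countType;
  src : edge -> vertex;
  tgt : edge -> vertex }.

Section GraphGroupoid.
Variable G : digraph.

(* Edges of the shadowed graph: [inl e] is e and [inr e] is e^{-1}. *)
Definition sedge : countType := (edge G + edge G)%type.

Definition shadow (e : sedge) : sedge :=
  match e with inl e => inr e | inr e => inl e end.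
Definition ssrc (e : sedge) : vertex G :=
  match e with inl e => src e | inr e => tgt e end.
Definition stgt (e : sedge) : vertex G :=
  match e with inl e => tgt e | inr e => src e end.

Implicit Types (v : vertex G) (e : sedge) (s : seq sedge).

Fixpoint walk v s : bool :=
  if s is e :: s' then (ssrc e == v) && walk (stgt e) s' else true.
Definition walk_end v s : vertex G := last v (map stgt s).

Definition reduced s : bool := sorted (fun e f => f != shadow e) s.

(* A nonempty element of the groupoid is a reduced walk together with its
   initial vertex; the vertex v is the walk of length 0 from v. *)
Record gword := GWord {
  gword_val : vertex G * seq sedge;
  _ : walk gword_val.1 gword_val.2 && reduced gword_val.2 }.
HB.instance Definition _ := [isSub for gword_val].
HB.instance Definition _ := [Countable of gword by <:].

Definition gsrc (w : gword) : vertex G := (val w).1.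
Definition gpath (w : gword) : seq sedge := (val w).2.
Definition gtgt (w : gword) : vertex G := walk_end (gsrc w) (gpath w).

Definition gvertices : set gword := [set w | gpath w = [::]].
Definition FPr : set gword := [set w | gpath w <> [::]].

Definition reduce_cons e s : seq sedge :=
  if s is f :: s' then (if f == shadow e then s' else e :: s) else [:: e].
Definition reduce s : seq sedge := foldr reduce_cons [::] s.

Lemma shadowK : involutive shadow. Proof. by case. Qed.
Lemma ssrc_shadow e : ssrc (shadow e) = stgt e. Proof. by case: e. Qed.
Lemma stgt_shadow e : stgt (shadow e) = ssrc e. Proof. by case: e. Qed.

Lemma walk_cat v s1 s2 :
  walk v (s1 ++ s2) = walk v s1 && walk (walk_end v s1) s2.
Proof. by elim: s1 v => //= e s1 IH v; rewrite IH andbA. Qed.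

Lemma walk_rev v s : walk v s ->
  walk (walk_end v s) (rev (map shadow s)) /\
  walk_end (walk_end v s) (rev (map shadow s)) = v.
Proof.
elim: s v => //= e s IH v /andP[/eqP se ws]; have [w1 w2] := IH _ ws.
rewrite rev_cons -cats1 walk_cat /walk_end map_cat last_cat /=.
rewrite ssrc_shadow stgt_shadow; split=> //.
by rewrite w1 /= andbT; move: w2; rewrite /walk_end => ->.
Qed.

Lemma reduced_rev s : reduced s -> reduced (rev (map shadow s)).
Proof.
rewrite /reduced rev_sorted sorted_map; apply: sub_sorted => e f /=.
by apply: contraNneq => ->; rewrite shadowK.
Qed.

Lemma ginv_subproof (w : gword) :
  walk (gtgt w) (rev (map shadow (gpath w))) &&
  reduced (rev (map shadow (gpath w))).
Proof.
case: w => -[v s] h; case/andP: (h) => /= ws rs.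
by rewrite /gtgt /gsrc /gpath /= (walk_rev ws).1 reduced_rev.
Qed.
Definition ginv (w : gword) : gword :=
  @GWord (gtgt w, rev (map shadow (gpath w))) (ginv_subproof w).

Lemma walk_reduce_cons v e s :
  walk v (e :: s) -> walk v (reduce_cons e s) /\
  walk_end v (reduce_cons e s) = walk_end (stgt e) s.
Proof.
rewrite /walk_end; case: s => [|f s] //= /and3P[/eqP <- /eqP fe ws].
case: eqP => [ef|_] /=; last by rewrite !eqxx fe eqxx ws.
by move: ws; rewrite ef stgt_shadow.
Qed.

Lemma walk_reduce v s : walk v s ->
  walk v (reduce s) /\ walk_end v (reduce s) = walk_end v s.
Proof.
elim: s v => //= e s IH v /andP[se /IH[w1 w2]].
have [|-> ->] := @walk_reduce_cons v e (reduce s); first by rewrite /= se.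
by rewrite w2.
Qed.

Lemma reduced_cons e s : reduced s -> reduced (reduce_cons e s).
Proof.
case: s => //= f s; case: eqP => [_|/eqP fe] rs.
  exact: path_sorted rs.
by rewrite /reduced /= fe.
Qed.

Lemma reduced_reduce s : reduced (reduce s).
Proof. by elim: s => //= e s /reduced_cons. Qed.

Lemma gmul_subproof (w1 w2 : gword) : gtgt w1 = gsrc w2 ->
  walk (gsrc w1) (reduce (gpath w1 ++ gpath w2)) &&
  reduced (reduce (gpath w1 ++ gpath w2)).
Proof.
case: w1 w2 => [[v1 s1] h1] [[v2 s2] h2]; rewrite /gtgt /gsrc /gpath /= => e12.
case/andP: h1 h2 => /= h1 _ /andP[/= h2 _].
rewrite reduced_reduce andbT; apply: (walk_reduce _).1.
by rewrite walk_cat h1 e12.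
Qed.

(* The product of the groupoid; [None] is the empty word. *)
Definition gmul (w1 w2 : gword) : option gword :=
  if @eqP _ (gtgt w1) (gsrc w2) is ReflectT e12
  then Some (@GWord (gsrc w1, reduce (gpath w1 ++ gpath w2))
                    (gmul_subproof e12))
  else None.

Lemma reduce_cat s1 s2 : reduce (s1 ++ s2) = foldr reduce_cons (reduce s2) s1.
Proof. exact: foldr_cat. Qed.

Lemma reduce_id s : reduced s -> reduce s = s.
Proof.
elim: s => //= e s IH rs; rewrite IH; last exact: path_sorted rs.
by case: s rs {IH} => //= f s /andP[/negPf->].
Qed.

Lemma reduce_consK e s : reduced s ->
  reduce_cons (shadow e) (reduce_cons e s) = s.
Proof.
case: s => [_|f s rs] /=; first by rewrite shadowK eqxx.
case: eqP => [<-|_] /=; last by rewrite shadowK eqxx.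
by case: s rs => //= g s /andP[/negPf->].
Qed.

Lemma gtgt_inv w : gtgt (ginv w) = gsrc w.
Proof.
case: w => -[v s] h; case/andP: (h) => /= ws rs.
by rewrite /gtgt /gsrc /gpath /= (walk_rev ws).2.
Qed.

Lemma gsrc_inv w : gsrc (ginv w) = gtgt w.
Proof. by []. Qed.

Lemma ginvK : involutive ginv.
Proof.
move=> w; apply/val_inj => /=; rewrite gtgt_inv /gpath /=.
rewrite map_rev revK -map_comp (eq_map (g := id)) ?map_id.
  by rewrite /gsrc; case: w => -[].
by move=> e /=; rewrite shadowK.
Qed.

Lemma gmulE w1 w2 : gmul w1 w2 =
  if gtgt w1 == gsrc w2 then
    insub (gsrc w1, reduce (gpath w1 ++ gpath w2)) else None.
Proof.
rewrite /gmul; case: eqP => // e12; rewrite insubT ?gmul_subproof// => h.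
by congr Some; apply/val_inj.
Qed.

Lemma gmulVP w u w' : gmul w w' = Some u -> gmul (ginv w) u = Some w'.
Proof.
rewrite {1}/gmul; case: eqP => // e12 [<-]; rewrite gmulE gtgt_inv.
rewrite {1}/gsrc /= eqxx gsrc_inv.
have -> : reduce (gpath (ginv w) ++ reduce (gpath w ++ gpath w')) = gpath w'.
  have rw' : reduced (gpath w') by rewrite /gpath; case: w' {e12} => p /= /andP[].
  rewrite !reduce_cat (reduce_id rw') reduce_id; last first.
    by elim: (gpath w) => //= e s /reduced_cons.
  rewrite [gpath (ginv w)](_ : _ = rev (map (@shadow) (gpath w))) //; elim: (gpath w) => //= e s IH.
  rewrite rev_cons foldr_rcons reduce_consK//.
  by elim: s {IH} => //= f s /reduced_cons.
rewrite e12 /gsrc /gpath -surjective_pairing; exact: valK.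
Qed.

Lemma gmulVE w u w' : (gmul (ginv w) u == Some w') = (gmul w w' == Some u).
Proof.
apply/eqP/eqP => [/gmulVP|]; last exact: gmulVP.
by rewrite ginvK.
Qed.

End GraphGroupoid.

Section Ell2.
Variables (R : realType) (J : choiceType).

Definition normsq (z : R[i]) : R := complex.Re z ^+ 2 + complex.Im z ^+ 2.

Definition sqsum (f : J -> R[i]) : \bar R :=
  \esum_(j in [set: J]) (normsq (f j))%:E.

Definition sqsummable : {pred J -> R[i]^o} := [pred f | (sqsum f < +oo)%E].

Lemma normsq_ge0 z : 0 <= normsq z.
Proof. by rewrite addr_ge0// sqr_ge0. Qed.

Lemma esumZ (c : R) (a : J -> \bar R) : 0 <= c -> (forall j, 0 <= a j)%E ->
  (\esum_(j in [set: J]) (c%:E * a j) <= c%:E * \esum_(j in [set: J]) a j)%E.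
Proof.
move=> c0 a0; apply: ge_ereal_sup => _ [X [finX _] <-].
rewrite -ge0_mule_fsumr//; apply: lee_wpmul2l; first by rewrite lee_fin.
by apply: ereal_sup_ubound; exists X.
Qed.

Lemma sqsummable_submod : submod_closed sqsummable.
Proof.
split=> [|a f g].
  by rewrite !inE /= /sqsum esum1// => j _; rewrite /normsq /= !expr0n addr0.
rewrite !inE /= => hf hg.
apply: (@le_lt_trans _ _ ((2 * normsq a)%:E * sqsum f + 2%:E * sqsum g)%E).
  have n0 : 0 <= 2 * normsq a by rewrite mulr_ge0// normsq_ge0.
  apply: (@le_trans _ _ (\esum_(j in [set: J])
     ((2 * normsq a)%:E * (normsq (f j))%:E + 2%:E * (normsq (g j))%:E)%E)).
    apply: le_esum => j _; rewrite -!EFinM -EFinD lee_fin /normsq.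
    rewrite [(a *: f + g) j](_ : _ = a * f j + g j)//.
    case: (f j) (g j) a {hf hg n0} => [x y] [z t] [b c] /=.
    have h1 := sqr_ge0 (b * x - c * y - z).
    have h2 := sqr_ge0 (b * y + c * x - t).
    nra.
  rewrite esumD => [|j _|j _]; last 2 first.
    by rewrite mule_ge0// lee_fin// normsq_ge0.
    by rewrite mule_ge0// lee_fin// normsq_ge0.
  by apply: leeD; apply: esumZ => // j; rewrite lee_fin normsq_ge0.
have p0 h : (0 <= sqsum h)%E by apply: esum_ge0 => j _; rewrite lee_fin normsq_ge0.
rewrite lte_add_pinfty// lte_mul_pinfty// lee_fin mulr_ge0//.
exact: normsq_ge0.
Qed.
HB.instance Definition _ :=
  GRing.isSubmodClosed.Build R[i] (J -> R[i]^o) sqsummable sqsummable_submod.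

Record ell2 := Ell2 { ell2_val :> J -> R[i]^o; _ : ell2_val \in sqsummable }.
HB.instance Definition _ := [isSub for ell2_val].
HB.instance Definition _ := [Choice of ell2 by <:].
HB.instance Definition _ := [SubChoice_isSubLmodule of ell2 by <:].

Definition ell2_norm (f : ell2) : R := Num.sqrt (fine (sqsum f)).

(* Unordered sums; meaningful for absolutely summable families only, such as
   the products f(j) g(j)^* of two square-summable families. *)
Definition rsum (a : J -> R) : R :=
  fine (\esum_(j in [set: J]) ((EFin \o a)^\+ j)%E) -
  fine (\esum_(j in [set: J]) ((EFin \o a)^\- j)%E).
Definition csum (a : J -> R[i]) : R[i] :=
  Complex (rsum (fun j => complex.Re (a j))) (rsum (fun j => complex.Im (a j))).

Definition inner (f g : ell2) : R[i] := csum (fun j => f j * (g j : R[i])^*).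

Lemma xi_subproof (j : J) :
  (fun k => (k == j)%:R : R[i]^o) \in sqsummable.
Proof.
rewrite inE /=.
rewrite /sqsum (_ : \esum_(k in _) _ = \esum_(k in [set j]) 1%:E)%E.
  by rewrite esum_set1 ?lee01// ltry.
rewrite [RHS]esum_mkcond; apply: eq_esum => k _.
rewrite /normsq; have [->|/eqP kj] := eqVneq k j.
  by rewrite mem_set//= expr1n expr0n addr0.
by rewrite memNset//= expr0n addr0.
Qed.

Definition xi (j : J) : ell2 := Ell2 (xi_subproof j).

Definition bounded_op (T : ell2 -> ell2) : Prop :=
  linear T /\ exists M : R, forall f, ell2_norm (T f) <= M * ell2_norm f.

Definition wot_closure (A : set (ell2 -> ell2)) : set (ell2 -> ell2) :=
  [set T | bounded_op T /\
    forall (s : seq (ell2 * ell2)) (eps : R), 0 < eps ->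
      exists2 S, A S &
        forall p, p \in s -> `|inner (T p.1 - S p.1) p.2| < (eps%:C)%C].

(* S = T^*. *)
Definition is_adjoint (T S : ell2 -> ell2) : Prop :=
  forall f g, inner (T f) g = inner f (S g).

Definition self_adjoint (T : ell2 -> ell2) : Prop := is_adjoint T T.

End Ell2.

Section GraphVonNeumannAlgebra.
Variables (R : realType) (G : digraph).

Local Notation H := (ell2 R (gword G)).

(* (L_w f)(u) = f(w^{-1} u), read as 0 when w^{-1} u is empty;
   by [lop_xi] this is the operator with L_w xi_{w'} = xi_{w w'}. *)
Definition lop_fun (w : gword G) (f : H) : gword G -> R[i]^o :=
  fun u => if gmul (ginv w) u is Some u' then f u' else 0.

Lemma lop_subproof w f : lop_fun w f \in @sqsummable R (gword G).
Proof.
suff h : (sqsum (lop_fun w f) <= sqsum f)%E.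
  by rewrite inE /=; apply: (le_lt_trans h); have := valP f; rewrite inE.
pose A := [set u : gword G | gsrc u = gsrc w].
pose B := [set u : gword G | gsrc u = gtgt w].
pose e u := odflt u (gmul (ginv w) u).
have eP u : A u -> gmul (ginv w) u = Some (e u).
  by rewrite /e /gmul => Au; case: eqP => //; rewrite gtgt_inv Au.
have bij : set_bij A B e.
  split=> [u Au|u u' /[!inE] Au Au' ee|u Bu] /=.
  - have := eP _ Au; rewrite /gmul; case: eqP => // h [<-]; rewrite /B /=.
    by rewrite [LHS]/gsrc.
  - have := eP _ Au; rewrite ee -(eP _ Au') => /eqP.
    rewrite (eP _ Au') gmulVE => /eqP h.
    by move/eqP: (eP _ Au'); rewrite gmulVE h => /eqP[].
  - have [u' hu'] : exists u', gmul w u = Some u'.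
      by rewrite /gmul; case: eqP => [h|]; [eexists | rewrite Bu].
    have Au' : A u'.
      by move: hu'; rewrite /gmul; case: eqP => // h [<-]; rewrite /A /= [LHS]/gsrc.
    exists u' => //; apply: Some_inj; rewrite -eP//; exact: gmulVP.
apply: (@le_trans _ _ (\esum_(u in B) (normsq (f u))%:E)%E); last first.
  rewrite /sqsum [leLHS]esum_mkcond; apply: le_esum => u _.
  by case: ifP => // _; rewrite lee_fin normsq_ge0.
rewrite (reindex_esum A B e)//.
rewrite [leRHS]esum_mkcond /sqsum; apply: le_esum => u _.
rewrite /lop_fun; case: ifPn => [/[!inE] /eP -> //|/negP nA].
rewrite /gmul; case: eqP => [h|_].
  by case: nA; rewrite inE /A /= -h gtgt_inv.
by rewrite /normsq /= expr0n addr0.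
Qed.

Definition lop (w : gword G) (f : H) : H := Ell2 (lop_subproof w f).

Lemma lop_xi w w' : lop w (xi R w') = oapp (@xi R (gword G)) 0 (gmul w w').
Proof.
apply/val_inj/funext => u; rewrite /= /lop_fun.
transitivity ((gmul w w' == Some u)%:R : R[i]).
  by rewrite -gmulVE; case: (gmul (ginv w) u).
by case: (gmul w w') => //= u'; rewrite [u == _]eq_sym.
Qed.

(* [gword] omits the empty word, whose operator is 0 and does not change the
   span. *)
Definition lop_span : set (H -> H) :=
  [set S | exists s : seq (R[i] * gword G),
    forall f, S f = \sum_(p <- s) p.1 *: lop p.2 f].

Definition graph_vN : set (H -> H) := wot_closure lop_span.

(* T = \sum_w t_w L_w : on each basis vector the series converges to the value
   of T, in the norm of H and along the net of finite sets of words.  For an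
   infinite support convergence on all vectors of H fails in general. *)
Definition expansion (T : H -> H) (t : gword G -> R[i]) : Prop :=
  forall (w' : gword G) (eps : R), 0 < eps ->
    exists A : {fset gword G}, forall B : {fset gword G}, (A `<=` B)%fset ->
      ell2_norm (T (xi R w') - \sum_(w <- B) t w *: lop w (xi R w')) < eps.

Definition Supp (t : gword G -> R[i]) : set (gword G) := [set w | t w != 0].

Definition graph_operator (T : H -> H) (t : gword G -> R[i]) : Prop :=
  [/\ graph_vN T, expansion T t & finite_set (Supp t)].

End GraphVonNeumannAlgebra.

(* Main.v *)
(* T acts on every vector as the finite sum of the t_w L_w, and the adjoint of
   L_w is L_{w^-1}; hence T is self-adjoint as soon as t_w is the conjugate of
   t_{w^-1} for every word w.  The converse compares the matrix entries of T at
   the basis vectors of w and of its terminal vertex.  Since the middle of a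
   reduced path w = w^-1 of positive length would be an edge equal to its
   shadow or an edge followed by its shadow, inversion has no fixed point on
   FP_r; X then collects the word of smaller code in each pair {w, w^-1} of the
   support. *)
Require Import Defs.
From HB Require Import structures.
From mathcomp Require Import all_boot all_order all_algebra finmap.
From mathcomp Require Import complex.
From mathcomp Require Import mathcomp_extra boolp classical_sets functions.
From mathcomp Require Import cardinality fsbigop reals ereal esum numfun.
From mathcomp Require Import ring lra.

Set Implicit Arguments.
Unset Strict Implicit.
Unset Printing Implicit Defensive.
Import Order.TTheory GRing.Theory Num.Theory.

Local Open Scope classical_set_scope.
Local Open Scope ring_scope.

(** * Linearity and reindexing of unordered real sums *)

Section RealSums.
Variables (R : realType) (J : choiceType).
Implicit Types (a b p q : J -> R) (f : J -> \bar R).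

Lemma summable_le a b : (forall j, `|a j| <= b j) ->
  summable [set: J] (EFin \o b) -> summable [set: J] (EFin \o a).
Proof.
move=> ab; apply: le_lt_trans; apply: le_esum => j _ /=.
by rewrite lee_fin (le_trans (ab j))// ler_norm.
Qed.

(** For positive [c] the reverse of [esumZ] is [esumZ] itself, applied to the inverse of [c] and the
    family [c * f]. *)
Lemma esumZl (c : R) f : 0 <= c -> (forall j, 0 <= f j)%E ->
  (\esum_(j in [set: J]) (c%:E * f j) = c%:E * \esum_(j in [set: J]) f j)%E.
Proof.
rewrite le_eqVlt => /predU1P[<- f0|c0 f0].
  by rewrite mul0e esum1// => j _; rewrite mul0e.
apply/eqP; rewrite eq_le; apply/andP; split; first exact/esumZ/f0/ltW.
have cf0 j : (0 <= c%:E * f j)%E by rewrite mule_ge0// lee_fin ltW.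
rewrite muleC -lee_pdivlMr// muleC.
apply: le_trans (esumZ _ cf0); last by rewrite invr_ge0 ltW.
apply: le_esum => j _.
by rewrite muleA -EFinM mulVf ?mul1e// gt_eqF.
Qed.

Lemma esum_fin_num p : (forall j, 0 <= p j) -> summable [set: J] (EFin \o p) ->
  \esum_(j in [set: J]) (p j)%:E \is a fin_num.
Proof.
move=> p0; rewrite summableE; congr (_ \is a fin_num).
by apply: eq_esum => j _ /=; rewrite ger0_norm.
Qed.

(** Frees [rsum] from the canonical positive and negative parts. Additivity needs this, because the
    positive part of a sum is not the sum of the positive parts. *)
Lemma rsumB p q : (forall j, 0 <= p j) -> (forall j, 0 <= q j) ->
  summable [set: J] (EFin \o p) -> summable [set: J] (EFin \o q) ->
  rsum (fun j => p j - q j) = fine (\esum_(j in [set: J]) (p j)%:E)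
                            - fine (\esum_(j in [set: J]) (q j)%:E).
Proof.
move=> p0 q0 sp sq; have spq := summableB sp sq.
rewrite -[RHS]fineB ?esum_fin_num//.
rewrite -[X in fine X](@esumB R J _ (EFin \o p) (EFin \o q))//; last 2 first.
  by move=> j _; rewrite lee_fin.
  by move=> j _; rewrite lee_fin.
rewrite fineB//.
  have := summable_funepos spq; rewrite summableE.
  by congr (_ \is a fin_num); apply: eq_esum => j _; rewrite gee0_abs ?funepos_ge0.
have := summable_funeneg spq; rewrite summableE.
by congr (_ \is a fin_num); apply: eq_esum => j _; rewrite gee0_abs ?funeneg_ge0.
Qed.

Let pos a j : R := Num.max (a j) 0.
Let neg a j : R := Num.max (- a j) 0.
Let pos_ge0 a j : 0 <= pos a j. Proof. by rewrite le_max lexx orbT. Qed.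
Let neg_ge0 a j : 0 <= neg a j. Proof. by rewrite le_max lexx orbT. Qed.

#[local] Hint Resolve pos_ge0 neg_ge0 : core.

Let posneg a : a = (fun j => pos a j - neg a j).
Proof.
apply/funext => j; rewrite /pos /neg; case: (leP (a j) 0) => aj; case: leP; lra.
Qed.

Let summable_pos a : summable [set: J] (EFin \o a) ->
  summable [set: J] (EFin \o pos a).
Proof.
move=> sa; apply: (@summable_le _ (fun j => `|a j|)) => [j|].
  by rewrite ger0_norm// ge_max ler_norm normr_ge0.
apply: le_lt_trans sa; apply: le_esum => j _ /=.
by rewrite lee_fin normr_id.
Qed.

Let summable_neg a : summable [set: J] (EFin \o a) ->
  summable [set: J] (EFin \o neg a).
Proof.
by rewrite summableN => /(@summable_pos (fun j => - a j)).
Qed.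

Lemma rsumN a : rsum (fun j => - a j) = - rsum a.
Proof.
rewrite /rsum opprB; congr (fine _ - fine _); apply: eq_esum => j _;
  by rewrite funeposE funenegE /= ?oppeK ?opprK.
Qed.

Lemma rsumD a b : summable [set: J] (EFin \o a) ->
  summable [set: J] (EFin \o b) ->
  rsum (fun j => a j + b j) = rsum a + rsum b.
Proof.
move=> sa sb.
rewrite (_ : (fun j => _) =
    (fun j => (pos a j + pos b j) - (neg a j + neg b j))); last first.
  by apply/funext => j; rewrite {1}(posneg a) {1}(posneg b); ring.
have [spa sna] := (summable_pos sa, summable_neg sa).
have [spb snb] := (summable_pos sb, summable_neg sb).
have D p q : (forall j, 0 <= p j) -> (forall j, 0 <= q j) ->
  summable [set: J] (EFin \o p) -> summable [set: J] (EFin \o q) ->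
  fine (\esum_(j in [set: J]) (p j + q j)%:E) =
  fine (\esum_(j in [set: J]) (p j)%:E) + fine (\esum_(j in [set: J]) (q j)%:E).
  move=> p0 q0 sp sq; rewrite -fineD ?esum_fin_num// -esumD//.
    by move=> j _; rewrite lee_fin.
  by move=> j _; rewrite lee_fin.
rewrite rsumB; last 4 first.
  by move=> j; rewrite addr_ge0.
  by move=> j; rewrite addr_ge0.
  exact: (summableD spa spb).
  exact: (summableD sna snb).
rewrite !D// [in RHS](posneg a) [in RHS](posneg b) !rsumB//; ring.
Qed.

Lemma rsumZ (c : R) a : rsum (fun j => c * a j) = c * rsum a.
Proof.
wlog c0 : c / 0 <= c => [H|].
  have [/H//|/ltW c0] := leP 0 c.
  rewrite -[c]opprK mulNr -H ?oppr_ge0// -rsumN.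
  by congr rsum; apply/funext => j; rewrite mulNr.
have E h : (forall j, 0 <= h j)%E ->
    fine (\esum_(j in [set: J]) (c%:E * h j)%E) =
    c * fine (\esum_(j in [set: J]) h j).
  (* No summability is required: [fine] sends an infinite sum to 0, and a positive multiple of an
     infinite sum is infinite again. *)
  move=> h0; rewrite esumZl//; case: (\esum_(j in _) _) => [r| |] //=.
  - rewrite mulr0; have [->|c0'] := eqVneq c 0; first by rewrite mul0e.
    by rewrite gt0_muley// lte_fin lt_def c0' c0.
  - rewrite mulr0; have [->|c0'] := eqVneq c 0; first by rewrite mul0e.
    by rewrite gt0_muleNy// lte_fin lt_def c0' c0.
rewrite /rsum mulrBr -!E; last 2 first.
- by move=> j; exact: funeneg_ge0.
- by move=> j; exact: funepos_ge0.
by congr (fine _ - fine _); apply: eq_esum => j _;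
  rewrite ?funeposE ?funenegE /= -?EFinM -?EFinN -EFin_max -EFin_max -EFinM
    maxr_pMr// mulr0 ?mulrN.
Qed.

Lemma rsum_single a i : (forall j, j != i -> a j = 0) -> rsum a = a i.
Proof.
move=> ai; have E (h : J -> \bar R) : (0 <= h i)%E -> (forall j, j != i -> h j = 0)%E ->
    \esum_(j in [set: J]) h j = h i.
  move=> h0 hi; rewrite -(esum_set1 h0) [RHS]esum_mkcond.
  apply: eq_esum => j _; have [->|ji] := eqVneq j i; first by rewrite mem_set.
  by rewrite memNset ?hi//; apply/eqP.
rewrite /rsum !E ?funepos_ge0 ?funeneg_ge0//; last 2 first.
- by move=> j /ai; rewrite funenegE /= => ->; rewrite oppr0 maxxx.
- by move=> j /ai; rewrite funeposE /= => ->; rewrite maxxx.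
by rewrite funeposE funenegE /= -!EFin_max [RHS](congr1 (@^~ i) (posneg a)).
Qed.

End RealSums.

(** The bijection links only sets outside which the families vanish, since translation by a word is
    a partial bijection of the groupoid. *)
Lemma rsum_reindex (R : realType) (I J : choiceType) (A : set I) (B : set J)
    (e : I -> J) (a : I -> R) (b : J -> R) : set_bij A B e ->
  (forall i, A i -> a i = b (e i)) -> (forall i, ~ A i -> a i = 0) ->
  (forall j, ~ B j -> b j = 0) -> rsum a = rsum b.
Proof.
move=> bij ab a0 b0.
have E (K : choiceType) (C : set K) (h : K -> \bar R) :
    (forall k, ~ C k -> h k = 0)%E ->
    \esum_(k in [set: K]) h k = \esum_(k in C) h k.
  move=> h0; rewrite [RHS]esum_mkcond; apply: eq_esum => k _.
  by case: ifPn => // /negP kC; apply: h0 => Ck; apply: kC; rewrite inE.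
rewrite /rsum !(E _ A) ?(E _ B); first last.
- by move=> j /a0; rewrite funeposE /= => ->; rewrite maxxx.
- by move=> j /a0; rewrite funenegE /= => ->; rewrite oppr0 maxxx.
- by move=> j /b0; rewrite funeposE /= => ->; rewrite maxxx.
- by move=> j /b0; rewrite funenegE /= => ->; rewrite oppr0 maxxx.
rewrite !(reindex_esum A B e _ bij); congr (fine _ - fine _);
  by apply: eq_esum => i Ai; rewrite ?funeposE ?funenegE /= ab.
Qed.

(** * Complex sums, the inner product, and truncation in the Hilbert space *)

Section ComplexSums.
Variables (R : realType) (J : choiceType).
Implicit Types (a b : J -> R[i]) (f g : ell2 R J).

Definition csummable a :=
  summable [set: J] (EFin \o (fun j => complex.Re (a j))) /\
  summable [set: J] (EFin \o (fun j => complex.Im (a j))).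

Lemma csummable_le a (p : J -> R) : (forall j, 0 <= p j) ->
  (forall j, normsq (a j) <= p j ^+ 2) ->
  summable [set: J] (EFin \o p) -> csummable a.
Proof.
move=> p0 ap sp; split; apply: summable_le sp => j;
  rewrite -[leRHS]ger0_norm// -ler_sqr ?nnegrE// !real_normK ?num_real//;
  apply: le_trans (ap j); rewrite /normsq ?lerDl ?lerDr sqr_ge0//.
Qed.

Lemma csumD a b : csummable a -> csummable b ->
  csum (fun j => a j + b j) = csum a + csum b.
Proof.
move=> [ra ia] [rb ib]; rewrite /csum [RHS]/GRing.add/=.
by rewrite -!rsumD//; congr Complex; congr rsum; apply/funext => j;
  case: (a j) (b j) => [? ?] [? ?].
Qed.

Lemma csumZ (c : R[i]) a : csummable a ->
  csum (fun j => c * a j) = c * csum a.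
Proof.
case: c => x y [ra ia].
have Z (z : R) (h : J -> R) : summable [set: J] (EFin \o h) ->
    summable [set: J] (EFin \o (fun j => z * h j)).
  rewrite /summable => sh.
  under eq_esum do rewrite /= normrM EFinM.
  by rewrite esumZl// lte_mul_pinfty// ?lee_fin.
rewrite /csum [RHS]/GRing.mul/=.
rewrite -mulNr -!rsumZ -!rsumD; [|exact: Z..].
by congr Complex; congr rsum; apply/funext => j;
  case: (a j) => [u v] /=; ring.
Qed.

Lemma csum_conj a : csum (fun j => (a j)^*) = (csum a)^*.
Proof.
rewrite /csum [RHS]/Num.conj/= -rsumN.
by congr Complex; congr rsum; apply/funext => j; case: (a j).
Qed.

Lemma csum_single a i : (forall j, j != i -> a j = 0) -> csum a = a i.
Proof.
move=> ai; rewrite /csum !(@rsum_single R J _ i); first by case: (a i).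
  by move=> j /ai ->.
by move=> j /ai ->.
Qed.

Lemma sqsum_fin f : sqsum f \is a fin_num.
Proof.
have := valP f; rewrite inE /= => h; rewrite fin_numElt h andbT.
by rewrite (lt_le_trans (ltNyr 0))// esum_ge0// => j _; rewrite lee_fin normsq_ge0.
Qed.

Lemma sqsum_summable f : summable [set: J] (EFin \o (fun j => normsq (f j))).
Proof.
rewrite summableE; have := sqsum_fin f; congr (_ \is a fin_num).
by apply: eq_esum => j _ /=; rewrite ger0_norm// normsq_ge0.
Qed.

(** The modulus of each product is at most |f(j)|^2 + |g(j)|^2; in squared form this is ab <= (a +
    b)^2 for nonnegative a and b. *)
Lemma inner_summable f g : csummable (fun j => f j * (g j : R[i])^*).
Proof.
apply: (@csummable_le _ (fun j => normsq (f j) + normsq (g j))).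
- by move=> j; rewrite addr_ge0 ?normsq_ge0.
- move=> j; rewrite /normsq.
  case: (f j) (g j) => [x y] [u v] /=.
  have := sqr_ge0 (x ^+ 2 + y ^+ 2); have := sqr_ge0 (u ^+ 2 + v ^+ 2).
  have : 0 <= (x ^+ 2 + y ^+ 2) * (u ^+ 2 + v ^+ 2).
    by rewrite mulr_ge0// addr_ge0 ?sqr_ge0.
  nra.
- exact: (summableD (sqsum_summable f) (sqsum_summable g)).
Qed.

Lemma innerDl f1 f2 g : inner (f1 + f2) g = inner f1 g + inner f2 g.
Proof.
rewrite /inner -csumD; [|exact: inner_summable..].
by congr csum; apply/funext => j; rewrite -mulrDl.
Qed.

Lemma innerZl c f g : inner (c *: f) g = c * inner f g.
Proof.
rewrite /inner -csumZ; last exact: inner_summable.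
by congr csum; apply/funext => j; rewrite mulrA.
Qed.

Lemma inner_conj f g : inner f g = (inner g f)^*.
Proof.
rewrite /inner -csum_conj; congr csum; apply/funext => j.
by rewrite rmorphM [RHS]mulrC; congr (_ * _); rewrite -[LHS]conjCK.
Qed.

Lemma inner_suml (I : Type) (r : seq I) (F : I -> ell2 R J) g :
  inner (\sum_(i <- r) F i) g = \sum_(i <- r) inner (F i) g.
Proof.
elim/big_rec2: _ => [|i x y _ <-]; last by rewrite innerDl.
by rewrite -[0 in LHS](scale0r (0 : ell2 R J)) innerZl mul0r.
Qed.

Lemma inner_xir f j : inner f (xi R j) = f j.
Proof.
rewrite /inner (csum_single (i := j)) /= ?eqxx ?rmorph1 ?mulr1//.
by move=> k /negPf ->; rewrite rmorph0 mulr0.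
Qed.

Lemma inner_xil f j : inner (xi R j) f = (f j : R[i])^*.
Proof. by rewrite inner_conj inner_xir. Qed.

Lemma ell2Z c f j : (c *: f) j = c * f j. Proof. by []. Qed.

Lemma ell2_sum (I : Type) (r : seq I) (F : I -> ell2 R J) j :
  (\sum_(i <- r) F i) j = \sum_(i <- r) F i j.
Proof. by rewrite -inner_xir inner_suml; under eq_bigr do rewrite inner_xir. Qed.

Lemma normsq_le f j : normsq (f j) <= ell2_norm f ^+ 2.
Proof.
have s0 : (0 <= sqsum f)%E by apply: esum_ge0 => k _; rewrite lee_fin normsq_ge0.
rewrite sqr_sqrtr ?fine_ge0// -lee_fin fineK ?sqsum_fin//.
rewrite -(@esum_set1 R J j (fun k => (normsq (f k))%:E)) ?lee_fin ?normsq_ge0//.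
rewrite esum_mkcond; apply: le_esum => k _.
by case: ifP => _; rewrite ?lee_fin ?normsq_ge0.
Qed.

Lemma normsq_eq0 (z : R[i]) : normsq z = 0 -> z = 0.
Proof.
case: z => x y; rewrite /normsq /= => /eqP; rewrite paddr_eq0 ?sqr_ge0//.
by rewrite !sqrf_eq0 => /andP[/eqP -> /eqP ->].
Qed.

Lemma ell2_trunc (B : {fset J}) f k :
  (\sum_(j <- B) f j *: xi R j) k = if k \in B then f k else 0.
Proof.
rewrite ell2_sum (eq_bigr (fun j => f j * (k == j)%:R : R[i]))//.
case: ifP => kB.
  rewrite (big_fsetD1 k)// eqxx mulr1 big_seq big1 => [|j]; first exact: addr0.
  by rewrite !inE eq_sym => /andP[/negPf -> _]; rewrite mulr0.
rewrite big_seq big1// => j jB.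
by case: eqVneq kB => [->|_ _]; rewrite ?jB ?mulr0.
Qed.

Lemma ell2_trunc_cvg f (eps : R) : 0 < eps -> exists A : {fset J},
  forall B : {fset J}, (A `<=` B)%fset ->
  ell2_norm (f - \sum_(j <- B) f j *: xi R j) < eps.
Proof.
move=> e0; have e20 : 0 < eps ^+ 2 by rewrite exprn_gt0.
(* The finite set [X] carries all of the squared norm of [f] except less than [eps ^+ 2]. The
   remainder [g] lives off [B], hence off [X], so its squared norm stays below that bound. *)
have [_ [X [finX _] <-] Xe] := ub_ereal_sup_adherent e20 (sqsum_fin f).
exists (fset_set X) => B AB; set g := f - _.
have n0 (h : ell2 R J) j : (0 <= (normsq (h j))%:E)%E by rewrite lee_fin normsq_ge0.
suff : (sqsum g < (eps ^+ 2)%:E)%E.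
  rewrite -(fineK (sqsum_fin g)) lte_fin => ge.
  by rewrite -[ltRHS]ger0_norm ?ltW// -sqrtr_sqr ltr_sqrt.
have gE : sqsum g =
    \esum_(j in [set: J] `&` ~` [set` B]) (normsq (f j))%:E.
  rewrite esum_mkcondr; apply: eq_esum => k _.
  rewrite [g k](_ : _ = f k - (\sum_(j <- B) f j *: xi R j) k)// ell2_trunc.
  case: ifPn => kB; last by rewrite subr0 mem_set//=; exact/negP.
  by rewrite subrr memNset/= /normsq /= ?expr0n ?addr0// => /(_ kB).
have := @esumID R J [set` B] [set: J] _ (fun j _ => n0 f j).
rewrite -gE -/(sqsum f) => fE.
have XB : (\sum_(j \in X) (normsq (f j))%:E <=
    \esum_(j in [set: J] `&` [set` B]) (normsq (f j))%:E)%E.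
  apply: ereal_sup_ubound; exists X => //; split=> // j Xj; split=> //=.
  by apply: (fsubsetP AB); rewrite in_fset_set// inE.
rewrite ltNge; apply/negP => ge.
move: Xe; rewrite ltNge => /negP; apply.
rewrite -[X in (_ <= X - _)%E]/(sqsum f) fE; apply: (le_trans XB).
rewrite leeBrDr//; exact: leeD.
Qed.

End ComplexSums.

(** * Inverses and units in the graph groupoid *)

Section GroupoidInverse.
Variable G : digraph.
Implicit Types w u : gword G.

(** Strong induction on the length, stripping both end letters: the last is the shadow of the first,
    and what lies between is again reduced and self-inverse, hence empty, which leaves an edge next
    to its shadow. *)
Lemma reduced_not_self_inverse (s : seq (sedge G)) :
  reduced s -> rev (map (@shadow G) s) = s -> s = [::].
Proof.
have [n] := ubnP (size s); elim: n s => // n IH [|e s]//.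
case/lastP: s => [_ _|m f].
  by rewrite /= => -[]; case: e.
rewrite /= size_rcons => /ltnSE/ltnW sm rs.
rewrite rev_cons map_rcons rev_rcons /= => -[ef /rcons_inj[mE _]].
have rm : reduced m.
  by move: rs => /path_sorted; rewrite -cats1 => /cat_sorted2[].
by move: rs; rewrite (IH m)// /reduced /= -ef shadowK eqxx.
Qed.

Lemma ginv_neq w : FPr w -> ginv w <> w.
Proof.
move=> wF ww; apply: wF; apply: reduced_not_self_inverse.
  by rewrite /gpath; case: w {ww} => p /= /andP[].
by rewrite -[in RHS]ww.
Qed.

Lemma FPr_inv w : FPr w -> FPr (ginv w).
Proof.
rewrite /FPr /= /gpath /= => + /(congr1 (@size _)).
by rewrite size_rev size_map => + /size0nil.
Qed.

Lemma ginv_vertex w : gvertices w -> ginv w = w.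
Proof.
case: w => -[v s] h; rewrite /gvertices /gpath /= => s0.
by apply/val_inj; rewrite /= /gtgt /gsrc /gpath /= s0.
Qed.

Definition gvert (v : vertex G) : gword G := @GWord G (v, [::]) isT.

(** A vertex is a right unit wherever the product is defined, so the entry of T in column
    [gvert (gtgt w)] and row [w] isolates the single coefficient of [w]. *)
Lemma gmul_vert w u : (gmul u (gvert (gtgt w)) == Some w) = (u == w).
Proof.
rewrite gmulE; have ru : reduced (gpath u).
  by rewrite /gpath; case: u => p /= /andP[].
rewrite [gpath (gvert _)]/gpath /= cats0 reduce_id// [gsrc (gvert _)]/gsrc /=.
rewrite /gsrc /gpath -surjective_pairing valK.
case: (eqVneq (gtgt u)) => [_|uw]; first by [].
by apply/esym/eqP => uE; rewrite uE eqxx in uw.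
Qed.

End GroupoidInverse.

(** * Adjoints of the L_w and the action of a graph operator *)

Section GroupoidOperators.
Variables (R : realType) (G : digraph).
Local Notation H := (ell2 R (gword G)).

Lemma lop_linear (w : gword G) : linear (@lop R G w).
Proof.
move=> a f g; apply/val_inj/funext => u /=.
rewrite [RHS](_ : _ = a * lop_fun w f u + lop_fun w g u)// /lop_fun.
by case: (gmul _ u) => //; rewrite [_ * _]mulr0 addr0.
Qed.
HB.instance Definition _ w :=
  GRing.isLinear.Build R[i] H H *:%R (@lop R G w) (lop_linear w).

Lemma lop_xiE (w w' u : gword G) :
  lop w (xi R w') u = (gmul w w' == Some u)%:R.
Proof.
by rewrite lop_xi; case: (gmul w w') => //= u'; rewrite eq_sym.
Qed.

(** Left multiplication by [ginv w] maps the range [A] of left multiplication by [w] bijectively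
    onto its domain [B], and it carries the terms of one inner product to those of the other. The
    default value in [e] is only taken off [A]. *)
Lemma lop_adjoint (w : gword G) : is_adjoint (@lop R G w) (lop (ginv w)).
Proof.
move=> f g; pose e u := odflt u (gmul (ginv w) u).
pose A := [set u | exists v, gmul w v = Some u].
pose B := [set v | exists u, gmul w v = Some u].
have eE u v : gmul w v = Some u -> e u = v by rewrite /e => /gmulVP ->.
have bij : set_bij A B e.
  split=> [u [v uv]|u u'|v [u uv]] /=; first by rewrite (eE _ _ uv); exists u.
    rewrite !inE => -[v uv] [v' uv']; rewrite (eE _ _ uv) (eE _ _ uv') => vv.
    by move: uv; rewrite vv uv' => -[].
  by exists u; [exists v|exact: eE].
pose a u := lop w f u * (g u : R[i])^*.
pose b v := f v * (lop (ginv w) g v : R[i])^*.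
have ab u : A u -> a u = b (e u).
  move=> [v uv]; rewrite (eE _ _ uv) /a /b /= /lop_fun ginvK uv.
  by rewrite (gmulVP uv).
have a0 u : ~ A u -> a u = 0.
  rewrite /a /= /lop_fun; case E : (gmul _ u) => [v|] nA; last exact: mul0r.
  by case: nA; exists v; apply/eqP; rewrite -gmulVE E.
have b0 v : ~ B v -> b v = 0.
  rewrite /b /= /lop_fun ginvK; case E : (gmul w v) => [u|] nB.
    by case: nB; exists u.
  by rewrite rmorph0 mulr0.
rewrite /inner /csum; congr Complex; apply: (rsum_reindex bij).
- by move=> u Au; rewrite -/(a u) ab.
- by move=> u Au; rewrite -/(a u) a0.
- by move=> u Bu; rewrite -/(b u) b0.
- by move=> u Au; rewrite -/(a u) ab.
- by move=> u Au; rewrite -/(a u) a0.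
- by move=> u Bu; rewrite -/(b u) b0.
Qed.

(** The net of partial sums is constant once it contains the support. A nonzero distance to the
    limit, taken as [eps], would therefore be smaller than itself. *)
Lemma expansion_xi (T : H -> H) t w : expansion T t -> finite_set (Supp t) ->
  T (xi R w) = \sum_(w' <- fset_set (Supp t)) t w' *: lop w' (xi R w).
Proof.
move=> Tt fint; apply/eqP; rewrite -subr_eq0; apply/eqP.
set F := fset_set _; set d := _ - _.
suff n0 : ell2_norm d = 0.
  apply/val_inj/funext => u; apply: normsq_eq0; apply/eqP.
  rewrite eq_le normsq_ge0 andbT.
  by have := normsq_le d u; rewrite n0 expr0n.
apply/eqP; apply/negPn/negP => n0.
have {n0}n0 : 0 < ell2_norm d by rewrite lt_def n0 sqrtr_ge0.
have [A /(_ (A `|` F)%fset (fsubsetUl _ _))] := Tt w _ n0.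
rewrite -(@big_fset_incl _ _ _ _ F) ?fsubsetUr//; first by rewrite ltxx.
move=> w' _; rewrite in_fset_set// notin_setE /Supp /= => /negP; rewrite negbK.
by move=> /eqP ->; rewrite scale0r.
Qed.

(* A bounded operator is determined by its columns; S is not known to be
   bounded, but each coordinate of S f depends on finitely many coordinates
   of f, so truncating f to a large finite set suffices. *)
Lemma expansion_apply (T : H -> H) t f : graph_operator T t ->
  T f = \sum_(w <- fset_set (Supp t)) t w *: lop w f.
Proof.
move=> [[[linT [M TM]] _] Tt fint]; set F := fset_set _.
pose S g : H := \sum_(w <- F) t w *: lop w g.
have linS : linear S.
  move=> a x y; rewrite /S scaler_sumr -big_split; apply: eq_bigr => w _ /=.
  by rewrite linearP scalerDr !scalerA mulrC.
pose D g := T g - S g.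
have linD : linear D.
  by move=> a x y; rewrite /D linT linS scalerBr opprD addrACA.
pose DL : {linear H -> H} := HB.pack D (GRing.isLinear.Build R[i] H H _ D linD).
have Dxi w : D (xi R w) = 0 by rewrite /D (expansion_xi w Tt fint) subrr.
apply/eqP; rewrite -subr_eq0 -/(S f) -/(D f); apply/eqP.
apply/val_inj/funext => u; apply: normsq_eq0; apply/eqP.
apply/negPn/negP => n0; have {n0}n0 : 0 < normsq (D f u).
  by rewrite lt_def n0 normsq_ge0.
(* With this [eps] the bound on T forces the coordinate [u] of [T g] to be smaller in modulus than
   that of [D f], although the two are equal. The denominator is positive whatever the sign of
   [M]. *)
pose eps := Num.sqrt (normsq (D f u)) / (`|M| + 1).
have M1 : 0 < `|M| + 1 by rewrite ltr_wpDl.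
have e0 : 0 < eps by rewrite divr_gt0// sqrtr_gt0.
have [A Af] := ell2_trunc_cvg f e0.
(* These include every index at which [S f u] reads [f]; the default only adds the harmless index
   [u]. *)
pose K : {fset gword G} := [fset odflt u (gmul (ginv w) u) | w in F]%fset.
have := Af (A `|` K)%fset (fsubsetUl _ _).
set g := f - _ => gE.
have Dg : D f = D g.
  rewrite /g -[RHS]/(DL _) raddfB raddf_sum/= big1 ?subr0// => w _.
  by rewrite -[LHS]/(DL _) linearZ /= Dxi scaler0.
have Sg : S g u = 0.
  rewrite /S ell2_sum big_seq big1// => w wF.
  rewrite ell2Z [lop w g u]/(lop_fun w g u) /lop_fun.
  case E : (gmul _ u) => [v|]; last exact: mulr0.
  rewrite [g v](_ : _ = f v - (\sum_(j <- (A `|` K)%fset) f j *: xi R j) v)//.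
  rewrite ell2_trunc ifT ?subrr ?mulr0// inE; apply/orP; right.
  by apply/imfsetP; exists w => //=; rewrite E.
have DT : D f u = T g u.
  by rewrite Dg [LHS](_ : _ = T g u - S g u)// Sg subr0.
have := normsq_le (T g) u; rewrite -DT; apply/negP; rewrite -ltNge.
rewrite -[ltRHS]sqr_sqrtr ?normsq_ge0// ltr_sqr ?nnegrE ?sqrtr_ge0//.
apply: le_lt_trans (TM g) _.
apply: (@le_lt_trans _ _ ((`|M| + 1) * ell2_norm g)).
  by rewrite ler_wpM2r ?sqrtr_ge0// (le_trans (ler_norm M))// lerDl.
by rewrite mulrC -ltr_pdivlMr.
Qed.

Lemma self_adjoint_coef (T : H -> H) t : graph_operator T t ->
  self_adjoint T <-> forall w, t w = (t (ginv w))^*.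
Proof.
move=> gT; have [_ Tt fint] := gT; pose F := fset_set (Supp t).
have tF w : w \notin F -> t w = 0.
  by rewrite in_fset_set// notin_setE /Supp /= => /negP; rewrite negbK => /eqP.
(* Covers both matrix entries: the identity for [p] gives the coefficient of a word, [ginv] that of
   its inverse. *)
have coef w' w u0 (p : gword G -> gword G) : involutive p ->
    (forall v, (gmul v w' == Some w) = (p v == u0)) -> T (xi R w') w = t (p u0).
  move=> pK pE; rewrite (expansion_apply _ gT) ell2_sum.
  rewrite (eq_bigr (fun v => t v * (v == p u0)%:R : R[i])); last first.
    by move=> v _; rewrite ell2Z lop_xiE pE -(inj_eq (inv_inj pK)) pK.
  have [pF|/tF t0] := boolP (p u0 \in F).
    rewrite (big_fsetD1 (p u0))//= eqxx mulr1 big_seq big1 => [|v].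
      exact: addr0.
    by rewrite !inE => /andP[/negPf -> _]; rewrite mulr0.
  by rewrite t0 big1// => v _; case: eqVneq => [->|_]; rewrite ?t0 ?mul0r ?mulr0.
split=> [sT w|tE f g].
  have := sT (xi R (gvert (gtgt w))) (xi R w).
  rewrite inner_xir inner_xil.
  rewrite (coef _ _ w id)//; last by move=> v; rewrite gmul_vert.
  rewrite (coef _ _ w (@ginv G))//; first exact: ginvK.
  by move=> v; rewrite -gmulVE gmul_vert.
rewrite [RHS]inner_conj !(expansion_apply _ gT) !inner_suml rmorph_sum.
(* The symmetry of the coefficients makes the support stable under inversion, so the sum may be
   reindexed by inverses. *)
have FV : perm_eq [seq ginv w | w <- F] F.
  apply: uniq_perm; rewrite ?map_inj_uniq ?fset_uniq//; first exact/inv_inj/ginvK.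
  have VF v : v \in F -> ginv v \in F.
    apply: contraLR => /tF; rewrite in_fset_set// notin_setE /Supp /= => t0.
    by rewrite tE t0 rmorph0 eqxx.
  move=> w; apply/mapP/idP => [[v vF ->]|wF]; first exact: VF.
  by exists (ginv w); rewrite ?ginvK// VF.
rewrite -/F -[LHS](perm_big _ FV) big_map; apply: eq_bigr => w _.
have cE : (inner (t w *: lop w g) f)^* = (t w)^* * inner f (lop w g).
  by rewrite innerZl [in RHS]inner_conj; exact: rmorphM.
rewrite [RHS]cE innerZl lop_adjoint ginvK; congr (_ * _).
by rewrite tE ginvK.
Qed.

End GroupoidOperators.

(** * Symmetry of the coefficients as a splitting of the support into inverse pairs *)

Theorem theorem3p1 (R : realType) (G : digraph)
  (T : ell2 R (gword G) -> ell2 R (gword G)) (t : gword G -> R[i])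
  (hT : graph_operator T t) :
  self_adjoint T <->
  (exists X : set (gword G),
     [/\ X `<=` Supp t,
         Supp t `&` @FPr G = X `|` (@ginv G @` X),
         X `&` (@ginv G @` X) = set0 &
         forall x, X x -> t x = (t (ginv x))^* ]) /\
  (forall v, (Supp t `&` @gvertices G) v -> t v \is Num.real).
Proof.
rewrite (self_adjoint_coef hT); split=> [tE|[[X [XS SX _ XE]] tR] w].
  have tV w : (t (ginv w) != 0) = (t w != 0).
    by rewrite [in RHS]tE conjC_eq0.
  split; last first.
    move=> v [_ vV]; apply/CrealP; rewrite [RHS]tE ginv_vertex//.
  exists [set w | [/\ Supp t w, FPr w & (choice.pickle w < choice.pickle (ginv w))%N]].
  split.
  - by move=> w [].
  - apply/seteqP; split=> [w [tw wF]|w [[tw wF _]|[x [tx xF _] <-]]].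
    + have : choice.pickle w != choice.pickle (ginv w).
        by apply/eqP => /(pcan_inj choice.pickleK)/esym; exact: ginv_neq.
      rewrite neq_ltn => /orP[lt|gt]; [by left|right].
      exists (ginv w); rewrite ?ginvK//; split; rewrite ?ginvK//.
        by rewrite /Supp /= tV.
      exact: FPr_inv.
    + by [].
    + by split; [rewrite /Supp /= tV|exact: FPr_inv].
  - rewrite -subset0 => w [[_ _ lt] [x [_ _ xlt] xw]].
    by move: lt; rewrite -xw ginvK ltnNge ltnW.
  - by move=> x _.
(* Condition (a) gives the relation on X only; on the inverses of X it follows by conjugating. *)
have main u : FPr u -> t u != 0 -> t u = (t (ginv u))^*.
  move=> uF tu; have : (X `|` (@ginv G @` X)) u by rewrite -SX.
  by case=> [/XE//|[x /XE xE <-]]; rewrite ginvK xE conjCK.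
have [w0|wF] := pselect (gpath w = [::]).
  rewrite ginv_vertex//; have [->|tw] := eqVneq (t w) 0; first by rewrite conjC0.
  by apply/esym/CrealP/tR.
(* Condition (a) is silent off the support. If only the coefficient of [w] vanishes, [main] is
   applied to the inverse word, and if both vanish the relation is trivial. *)
have [tw|] := eqVneq (t w) 0; last exact: main.
have [->|tv] := eqVneq (t (ginv w)) 0; first by rewrite conjC0.
by rewrite (main _ (FPr_inv wF) tv) ginvK conjCK.
Qed.
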